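(* Consider MC-moments Parareal for scalar McKean-Vlasov SDEs with $P$ particles, either in its unimodal version or in its multimodal version (both defined in the context). Suppose that the same random numbers are used in each iteration, i.e. the random numbers in the fine propagator $\mathcal F_n$ depend on $n$ but not on the iteration index $k$, and are also those used in the sequential simulation $u_{n+1}=\mathcal F_n(u_n)$. Then for all $k\ge n\ge 0$, $$u_n^k=u_n\qquad\text{and}\qquad \rho_n^k=\mathcal R(u_n),$$ that is, the particle ensemble converges exactly to the sequential simulation. In particular, the strong error $\max_{1\le p\le P}\mathbb E\big[|(u_n^k)^{(p)}-(u_n)^{(p)}|\big]$ and, for any function $\Phi$ for which the expectations exist, the weak error $\big|\mathbb E[\mathbb E_P[\Phi(u_n^k)]]-\mathbb E[\mathbb E_P[\Phi(u_n)]]\big|$ with respect to the sequential simulation are zero for all $k\ge n$.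
   Context: **Notation.** A micro state is an ensemble $u=(u^{(p)})_{p=1}^P\in\mathbb R^P$. $\mathbb E_P[u]$ and $\mathbb V_P[u]$ are its empirical mean and variance, $\mathbb E_P[\Phi(u)]=\frac1P\sum_p\Phi(u^{(p)})$. **Fine propagator.** $\mathcal F_n:\mathbb R^P\to\mathbb R^P$ is the Euler-Maruyama discretisation over the $n$-th time slice of the particle system $dX^{(p)}=a(X^{(p)},\lambda_P,t)\,dt+b(X^{(p)},\lambda_P,t)\,dW^{(p)}$, with $\lambda_P$ the empirical measure: each step of size $\Delta t$ is $X^{(p)}_{m+1}=X^{(p)}_m+a(X^{(p)}_m,\lambda_P,t_m)\Delta t+b(X^{(p)}_m,\lambda_P,t_m)\sqrt{\Delta t}\,\xi$ with $\xi$ standard normal draws. With the random numbers fixed, $\mathcal F_n$ is a deterministic map. The sequential simulation is $u_{n+1}=\mathcal F_n(u_n)$, started from the given $u_0$. **Moment model.** An ODE system $\dot M=\mathsf F(M,\Sigma)$, $\dot\Sigma=\mathsf G(M,\Sigma)$ approximating the evolution of mean and variance, which is one of the following: - the Gaussian model $\dot M=\int a\,p\,dx$, $\dot\Sigma=2\int (x-M)a\,p\,dx+\int b^2 p\,dx$, with $p$ the normal density with mean $M$ and variance $\Sigma$; - the Taylor model, for coefficients of the form $a(X,\mathbb E[f(X)],t)$, $b(X,\mathbb E[f(X)],t)$: $\dot M=a+\frac12a_{XX}+\frac12 b_{XX}\Sigma$, $\dot\Sigma=[2a_X+b_X^2]\Sigma+b^2$, with all functions evaluated at $(M,f(M),t)$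 and subscripts $X$ denoting derivatives in the first argument. The (deterministic) propagator of this ODE over a time slice is assumed to be defined at every macro state encountered. **Transformation.** For $\mu\in\mathbb R$, $\sigma\ge0$ and an ensemble $u$: $\mathcal T([\mu,\sigma],u)=\sqrt{\sigma/\mathbb V[u]}\,(u-\mathbb E[u])+\mu$ if $\mathbb V[u]\ne0$, and $\mathcal T([\mu,\sigma],u)=\sqrt\sigma\,\xi+\mu$ with $\xi$ standard normal draws if $\mathbb V[u]=0$ (componentwise, with empirical mean and variance). **Generalised Parareal iteration.** With restriction $\mathcal R$ (micro to macro), lifting $\mathcal L$ (macro to micro), coarse propagator $\mathcal C_n$ on macro states and iterator function $\mathcal I$: $u_0^k=u_0$, $\rho_0^k=\mathcal R(u_0)$ for all $k\ge0$; and for $n,k\ge0$ $$(\rho_{n+1}^0,u_{n+1}^0)=\big(\mathcal C_n(\rho_n^0),\mathcal L(\mathcal C_n(\rho_n^0))\big),\qquad(\rho_{n+1}^{k+1},u_{n+1}^{k+1})=\mathcal I\big(\mathcal C_n(\rho_n^{k+1}),\mathcal F_n(u_n^k),\mathcal C_n(\rho_n^k)\big).$$ **Unimodal version.** Macro state $\rho=(M,\Sigma)$; $\mathcal R(u)=[\mathbb E_P[u],\mathbb V_P[u]]$; $\mathcal C_n$ is the propagator of the moment model; $\mathcal L(\rho)=\mathcal T(\rho,u_0)$. With $\alpha=a+\mathcal R(b)-c$ (componentwise) and $\alpha_{\mathbb V}$ its variance component, $\mathcal I(a,b,c)=(\alpha,\mathcal T(\alpha,b))$ if $\alpha_{\mathbb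 V}\ge0$, and $\mathcal I(a,b,c)=(\mathcal R(b),b)$ otherwise. **Multimodal version.** The state space $\mathbb R$ is partitioned into known disjoint regions $\mathcal D_1,\dots,\mathcal D_I$. For an ensemble $u$, $\mathcal P_{\mathcal D_i}(u)$ is the fraction of particles lying in $\mathcal D_i$, and $\mathbb E_{\mathcal D_i}[u]$, $\mathbb V_{\mathcal D_i}[u]$ are the mean and variance of the particles lying in $\mathcal D_i$ (set to a fixed default value if there are none). The macro state is $\rho=(\mathcal P_i,M_i,\Sigma_i)_{i=1}^I$, and $\mathcal R(u)=(\mathcal R_i(u))_i$ with $\mathcal R_i(u)=(\mathcal P_{\mathcal D_i}(u),\mathbb E_{\mathcal D_i}[u],\mathbb V_{\mathcal D_i}[u])$. $\mathcal C_n$ applies the propagator of the moment model to each pair $(M_i,\Sigma_i)$ separately and leaves each $\mathcal P_i$ unchanged. Lifting moves, for each region, the particles of $u_0$ in $\mathcal D_i$ by $\mathcal T((M_i,\Sigma_i),\cdot)$. The iterator acts region by region. For region $i$, let $\alpha=a+\mathcal R_i(b)-c$ (with $a,c$ the $i$-th components of the macro arguments), except that $\alpha=a$ if $\mathcal P_{\mathcal D_i}(b)=0$ and $n>k$; let $\alpha_{\mathbb V}$ be the variance component of $\alpha$, and let $\mathcal T(\alpha,b)$ denote $\mathcal T$ applied, with the mean and variance components of $\alpha$, to the particles of $b$ in $\mathcal D_i$. Then $\mathcal I_i(a,b,c)=(\alpha,\mathcal T(\alpha,b))$ if $\mathcal P_{\mathcal D_i}(b)\neq 0$, $\alpha_{\mathbb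 V}\ge0$ and $\mathcal P_{\mathcal D_i}(\mathcal T(\alpha,b))=\mathcal P_{\mathcal D_i}(b)$ (the moved particles stay in the region); otherwise $\mathcal I_i(a,b,c)=(\mathcal R_i(b),b)$, i.e. the particles of $b$ in $\mathcal D_i$ are left unchanged. The fraction components of the new macro state are $\mathcal P_{i,n+1}^{k+1}=\mathcal P_{\mathcal D_i}(\mathcal F_n(u_n^k))$. *)

(* Defs.v *)
From HB Require Import structures.
From mathcomp Require Import all_boot all_order all_algebra.
From mathcomp Require Import all_classical all_reals all_analysis.

Set Implicit Arguments.
Unset Strict Implicit.
Unset Printing Implicit Defensive.

Import Order.TTheory GRing.Theory Num.Theory.
Import numFieldNormedType.Exports.

Local Open Scope classical_set_scope.
Local Open Scope ring_scope.

Section Ensembles.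
Context {R : realType} {P : nat}.
Implicit Types (A : pred 'I_P) (u : 'rV[R]_P).

(* Statistics of the particles with index in A. For A = predT the weight is
   P%:R^-1, and these are the empirical mean and variance E_P and V_P. *)
Definition emp_mean_of A (Phi : R -> R) u : R :=
  #|A|%:R^-1 * \sum_(p in A) Phi (u ord0 p).

Definition emp_mean A u : R := emp_mean_of A id u.

Definition emp_var A u : R :=
  emp_mean_of A (fun x => (x - emp_mean A u) ^+ 2) u.

Definition in_region (D : set R) u : pred 'I_P := fun p => u ord0 p \in D.

Definition fraction (D : set R) u : R := #|in_region D u|%:R / P%:R.

(* The particles with index in A are moved to mean rho.1 and variance rho.2,
   the others stay where they are; xi p is the draw of particle p. *)
Definition transform A (rho : R * R) (xi u : 'rV[R]_P) : 'rV[R]_P :=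
  \row_p
    if ~~ A p then u ord0 p
    else if emp_var A u != 0 then
      Num.sqrt (rho.2 / emp_var A u) * (u ord0 p - emp_mean A u) + rho.1
    else Num.sqrt rho.2 * xi ord0 p + rho.1.

(* P^-1 * sum_p dirac (u p); every index k < P in msum is an ordinal, so the
   default 0 of oapp is never used. The normalisation default dirac 0 only
   concerns P = 0. *)
Definition empirical u : probability (measurableTypeR R) R :=
  mnormalize
    (msum (fun k => \d_(oapp (u ord0) 0 (insub k) : measurableTypeR R)) P)
    (\d_(0 : measurableTypeR R)).

End Ensembles.

Section MomentModels.
Context {R : realType}.

(* The particle coefficients, with the moment model that is built from them:
   either a(X, lambda, t), b(X, lambda, t) with the Gaussian model, or
   a(X, E[f(X)], t), b(X, E[f(X)], t) with the Taylor model. *)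
Variant moment_model : Type :=
| GaussianModel (a b : R -> probability (measurableTypeR R) R -> R -> R)
| TaylorModel (f : R -> R) (a b : R -> R -> R -> R).

Definition drift P (mdl : moment_model) (x : R) (u : 'rV[R]_P) (t : R) : R :=
  match mdl with
  | GaussianModel a _ => a x (empirical u) t
  | TaylorModel f a _ => a x (emp_mean_of predT f u) t
  end.

Definition diffusion P (mdl : moment_model) (x : R) (u : 'rV[R]_P) (t : R) : R :=
  match mdl with
  | GaussianModel _ b => b x (empirical u) t
  | TaylorModel f _ b => b x (emp_mean_of predT f u) t
  end.

(* Normal law with mean M and variance S >= 0. The library's normal_prob takes
   the standard deviation and is the uniform law on [0, 1] when that is 0; the
   degenerate normal law is the Dirac mass at M. *)
Definition gaussian_law (M S : R) : probability (measurableTypeR R) R :=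
  if 0 < S then (normal_prob M (Num.sqrt S) : probability (measurableTypeR R) R)
  else (\d_(M : measurableTypeR R) : probability (measurableTypeR R) R).

Definition gaussian_integral (M S : R) (h : R -> R) : R :=
  if 0 < S then
    \int[lebesgue_measure]_x (h x * normal_pdf M (Num.sqrt S) x)
  else h M.

Definition gaussian_integrable (M S : R) (h : R -> R) : Prop :=
  0 < S -> lebesgue_measure.-integrable [set: R]
             (EFin \o (fun x => h x * normal_pdf M (Num.sqrt S) x)).

Definition twice_derivable (g : R -> R) (x : R) : Prop :=
  (\forall y \near x, derivable g y 1) /\ derivable (derive1 g) x 1.

(* Macro states at which the right-hand side of the moment ODE makes sense. *)
Definition moment_domain (mdl : moment_model) (t M S : R) : Prop :=
  match mdl with
  | GaussianModel a b =>
      let p := gaussian_law M S in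
      [/\ 0 <= S,
          gaussian_integrable M S (fun x => a x p t),
          gaussian_integrable M S (fun x => (x - M) * a x p t) &
          gaussian_integrable M S (fun x => b x p t ^+ 2)]
  | TaylorModel f a b =>
      twice_derivable (fun x => a x (f M) t) M /\
      twice_derivable (fun x => b x (f M) t) M
  end.

Definition moment_rhs (mdl : moment_model) (t M S : R) : R * R :=
  match mdl with
  | GaussianModel a b =>
      let p := gaussian_law M S in
      (gaussian_integral M S (fun x => a x p t),
       2 * gaussian_integral M S (fun x => (x - M) * a x p t)
         + gaussian_integral M S (fun x => b x p t ^+ 2))
  | TaylorModel f a b =>
      let aX : R -> R := fun x => a x (f M) t in
      let bX : R -> R := fun x => b x (f M) t in
      (aX M + 2^-1 * derive1n 2 aX M + 2^-1 * derive1n 2 bX M * S,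
       (2 * derive1 aX M + derive1 bX M ^+ 2) * S + bX M ^+ 2)
  end.

Definition moment_solution (mdl : moment_model) (s e : R) (M S : R -> R) : Prop :=
  [/\ {within `[s, e], continuous M},
      {within `[s, e], continuous S} &
      forall t, t \in `]s, e[ ->
        [/\ moment_domain mdl t (M t) (S t),
            is_derive t 1 M (moment_rhs mdl t (M t) (S t)).1 &
            is_derive t 1 S (moment_rhs mdl t (M t) (S t)).2]].

(* The propagator over [s, e] is defined at rho, and its value is C rho. *)
Definition propagates (mdl : moment_model) (s e : R) (C : R * R -> R * R)
    (rho : R * R) : Prop :=
  exists M S : R -> R,
    [/\ moment_solution mdl s e M S, (M s, S s) = rho & (M e, S e) = C rho].

End MomentModels.

Section FinePropagator.
Context {R : realType} {P : nat}.
Variables (mdl : @moment_model R) (dt t0 : R) (xi : nat -> 'rV[R]_P).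

Definition em_step (t : R) (z u : 'rV[R]_P) : 'rV[R]_P :=
  \row_p (u ord0 p + drift mdl (u ord0 p) u t * dt
          + diffusion mdl (u ord0 p) u t * Num.sqrt dt * z ord0 p).

(* N Euler-Maruyama steps of size dt from time t0, with draws xi 0, xi 1, ... *)
Fixpoint fine_propagator (N : nat) (u : 'rV[R]_P) : 'rV[R]_P :=
  if N is m.+1 then em_step (t0 + m%:R * dt) (xi m) (fine_propagator m u)
  else u.

End FinePropagator.

Fixpoint sequential (micro : Type) (F : nat -> micro -> micro) (u0 : micro)
    (n : nat) : micro :=
  if n is m.+1 then F m (sequential F u0 m) else u0.

Section Parareal.
Variables (macro micro : Type).
Variables (restr : micro -> macro) (lift : nat -> macro -> micro).
Variables (C : nat -> macro -> macro) (F : nat -> micro -> micro).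
Variable iterator : nat -> nat -> macro -> micro -> macro -> macro * micro.
Variable u0 : micro.

(* parareal k n is (rho_n^k, u_n^k). The extra indices let the draws in the
   lifting and in the iterator depend on (n, k); F has no index k, since the
   random numbers of the fine propagator are the same in each iteration. *)
Fixpoint parareal (k : nat) : nat -> macro * micro :=
  match k with
  | 0 =>
      fix row (n : nat) : macro * micro :=
        match n with
        | 0 => (restr u0, u0)
        | m.+1 => let rho := C m (row m).1 in (rho, lift m rho)
        end
  | j.+1 =>
      fix row (n : nat) : macro * micro :=
        match n with
        | 0 => (restr u0, u0)
        | m.+1 => iterator m j (C m (row m).1) (F m (parareal j m).2)
                    (C m (parareal j m).1)
        end
  end.

End Parareal.

(* In both versions zeta n k holds the draws of the transformations used for
   u_{n+1}^k, in the lifting (k = 0) or in the iterator (k > 0). *)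

Section Unimodal.
Context {R : realType} {P : nat}.
Variables (C : nat -> R * R -> R * R) (F : nat -> 'rV[R]_P -> 'rV[R]_P).
Variables (zeta : nat -> nat -> 'rV[R]_P) (u0 : 'rV[R]_P).

Definition uni_restr (u : 'rV[R]_P) : R * R := (emp_mean predT u, emp_var predT u).

Definition uni_lift (n : nat) (rho : R * R) : 'rV[R]_P :=
  transform predT rho (zeta n 0) u0.

Definition uni_iterator (n k : nat) (a : R * R) (b : 'rV[R]_P) (c : R * R) :
    (R * R) * 'rV[R]_P :=
  let alpha := a + uni_restr b - c in
  if 0 <= alpha.2 then (alpha, transform predT alpha (zeta n k.+1) b)
  else (uni_restr b, b).

Definition unimodal : nat -> nat -> (R * R) * 'rV[R]_P :=
  parareal uni_restr uni_lift C F uni_iterator u0.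

End Unimodal.

Section Multimodal.
Context {R : realType} {P I : nat}.
Variables (D : 'I_I -> set R) (dflt : 'I_I -> R * R).
Variables (C : nat -> R * R -> R * R) (F : nat -> 'rV[R]_P -> 'rV[R]_P).
Variables (zeta : nat -> nat -> 'rV[R]_P) (u0 : 'rV[R]_P).

(* (P_i, (M_i, Sigma_i)) for each region i *)
Definition multi_macro : Type := {ffun 'I_I -> R * (R * R)}.

(* dflt i is the default (mean, variance) of region i when it is empty. *)
Definition multi_restr_region (u : 'rV[R]_P) (i : 'I_I) : R * (R * R) :=
  let A := in_region (D i) u in
  (fraction (D i) u,
   if #|A| == 0%N then dflt i else (emp_mean A u, emp_var A u)).

Definition multi_restr (u : 'rV[R]_P) : multi_macro :=
  [ffun i => multi_restr_region u i].

Definition multi_coarse (n : nat) (rho : multi_macro) : multi_macro :=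
  [ffun i => ((rho i).1, C n (rho i).2)].

(* Collects v i, which only concerns the particles of u in D i, over all i. *)
Definition assemble (u : 'rV[R]_P) (v : 'I_I -> 'rV[R]_P) : 'rV[R]_P :=
  \row_p if [pick i | in_region (D i) u p] is Some i then v i ord0 p
         else u ord0 p.

Definition multi_lift (n : nat) (rho : multi_macro) : 'rV[R]_P :=
  assemble u0
    (fun i => transform (in_region (D i) u0) (rho i).2 (zeta n 0) u0).

Definition multi_iterator_region (n k : nat) (i : 'I_I) (a : R * (R * R))
    (b : 'rV[R]_P) (c : R * (R * R)) : (R * (R * R)) * 'rV[R]_P :=
  let alpha :=
    if (fraction (D i) b == 0) && (k < n)%N then a
    else a + multi_restr_region b i - c in
  let Tb := transform (in_region (D i) b) alpha.2 (zeta n k.+1) b in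
  if [&& fraction (D i) b != 0, 0 <= alpha.2.2
       & fraction (D i) Tb == fraction (D i) b]
  then (alpha, Tb) else (multi_restr_region b i, b).

Definition multi_iterator (n k : nat) (a : multi_macro) (b : 'rV[R]_P)
    (c : multi_macro) : multi_macro * 'rV[R]_P :=
  let r i := multi_iterator_region n k i (a i) b (c i) in
  ([ffun i => (fraction (D i) b, (r i).1.2)], assemble b (fun i => (r i).2)).

Definition multimodal : nat -> nat -> multi_macro * 'rV[R]_P :=
  parareal multi_restr multi_lift multi_coarse F multi_iterator u0.

End Multimodal.

Section Randomness.
Context {d : measure_display} {Omega : measurableType d} {R : realType}.
Variable Pr : probability Omega R.

Definition mutually_independent (J : eqType) (X : J -> {RV Pr >-> R}) : Prop :=
  forall (s : seq J) (A : J -> set R), uniq s ->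
    (forall j, measurable (A j)) ->
    Pr (\bigcap_(j in [set` s]) (X j @^-1` A j)) =
    (\prod_(j <- s) Pr (X j @^-1` A j))%E.

Definition iid_standard_normal (J : eqType) (X : J -> {RV Pr >-> R}) : Prop :=
  mutually_independent X /\
  forall j (A : set R), measurable A ->
    distribution Pr (X j) A = normal_prob (0 : R) 1 A.

Definition sample P (X : 'I_P -> {RV Pr >-> R}) (w : Omega) : 'rV[R]_P :=
  \row_p X p w.

Definition strong_error P (u v : Omega -> 'rV[R]_P) : \bar R :=
  (\big[maxe/0]_(p < P) 'E_Pr[fun w => (`|u w ord0 p - v w ord0 p|)%R])%E.

Definition ensemble_mean P (Phi : R -> R) (u : Omega -> 'rV[R]_P) : Omega -> R :=
  fun w => emp_mean_of predT Phi (u w).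

Definition weak_error P (Phi : R -> R) (u v : Omega -> 'rV[R]_P) : \bar R :=
  (`| 'E_Pr[ensemble_mean Phi u] - 'E_Pr[ensemble_mean Phi v] |)%E.

(* run w k n is (rho_n^k, u_n^k) and useq w n is u_n, on the realisation w. *)
Definition converges_exactly P (macro : Type) (restr : 'rV[R]_P -> macro)
    (run : Omega -> nat -> nat -> macro * 'rV[R]_P)
    (useq : Omega -> nat -> 'rV[R]_P) : Prop :=
  forall k n : nat, (n <= k)%N ->
    [/\ forall w, (run w k n).2 = useq w n /\ (run w k n).1 = restr (useq w n),
        strong_error (fun w => (run w k n).2) (useq^~ n) = 0%E &
        forall Phi : R -> R,
          Pr.-integrable [set: Omega]
            (EFin \o ensemble_mean Phi (fun w => (run w k n).2)) ->
          Pr.-integrable [set: Omega] (EFin \o ensemble_mean Phi (useq^~ n)) ->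
          weak_error Phi (fun w => (run w k n).2) (useq^~ n) = 0%E].

End Randomness.

(* Main.v *)
Require Import Defs.
From HB Require Import structures.
From mathcomp Require Import all_boot all_order all_algebra.
From mathcomp Require Import all_classical all_reals all_analysis.

Import Order.TTheory GRing.Theory Num.Theory.
Import numFieldNormedType.Exports.

Local Open Scope classical_set_scope.
Local Open Scope ring_scope.

(* On the diagonal k >= n the coarse corrections cancel: by induction on n the
   two coarse arguments of the iterator agree, so the iterator is asked to move
   the ensemble F_n(u_n) to its own mean and variance, which moves nothing. *)

(** The entry in column [n.+1] of iteration [k.+1] is the iterator's output at indices [n], [k], so
    the range [n <= k] of the hypothesis is exactly what the conclusion calls for. *)
Lemma parareal_finite_termination (macro micro : Type)
    (restr : micro -> macro) (lift : nat -> macro -> micro)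
    (C : nat -> macro -> macro) (F : nat -> micro -> micro)
    (iterator : nat -> nat -> macro -> micro -> macro -> macro * micro)
    (u0 : micro) :
  (forall n k a b, (n <= k)%N -> iterator n k a b a = (restr b, b)) ->
  forall n k, (n <= k)%N ->
    parareal restr lift C F iterator u0 k n =
    (restr (sequential F u0 n), sequential F u0 n).
Proof.
move=> iterator_id; elim=> [|n IHn] [|k] // le_nk.
(* Two iterations enter: [k.+1] supplies the new coarse argument, [k] the old one and the ensemble
   passed to [F n]. *)
have /= -> := IHn k.+1 (leqW le_nk).
by rewrite (IHn k le_nk) iterator_id.
Qed.

Section TransformToOwnStatistics.
Context {R : realType} {P : nat}.
Implicit Types (A : pred 'I_P) (xi u : 'rV[R]_P).

Lemma emp_var_ge0 A u : 0 <= emp_var A u.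
Proof.
by rewrite mulr_ge0 ?invr_ge0 ?ler0n// sumr_ge0// => p _; exact: sqr_ge0.
Qed.

Lemma emp_var_eq0 A u (p : 'I_P) :
  emp_var A u = 0 -> A p -> u ord0 p = emp_mean A u.
Proof.
(* A zero weight means that [A] is empty, which [Ap] excludes; otherwise a vanishing sum of squares
   has only vanishing terms. *)
move=> /eqP; rewrite mulf_eq0 invr_eq0 pnatr_eq0 => /orP[/eqP/card0_eq A0|] Ap.
  by have := A0 p; rewrite unfold_in Ap.
move: Ap; rewrite psumr_eq0 => [/allP/(_ p)|q _]; last exact: sqr_ge0.
rewrite mem_index_enum => /(_ isT)/implyP H Ap.
by have := H Ap; rewrite sqrf_eq0 subr_eq0 => /eqP.
Qed.

(** For nonzero variance the scaling factor is sqrt 1. For zero variance the draws get weight sqrt 0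
    and every particle of [A] already sits at the mean, so the value of [xi] does not matter. *)
Lemma transform_id A xi u : transform A (emp_mean A u, emp_var A u) xi u = u.
Proof.
apply/rowP => p; rewrite mxE /=; case: ifPn => // /negPn Ap.
have [v0|v0] := eqVneq (emp_var A u) 0.
  by rewrite /= v0 sqrtr0 mul0r add0r (emp_var_eq0 _ _ _ v0 Ap).
by rewrite /= divff// sqrtr1 mul1r subrK.
Qed.

End TransformToOwnStatistics.

Section IteratorsAgreeingCoarseArguments.
Context {R : realType} {P : nat}.
Variable zeta : nat -> nat -> 'rV[R]_P.

Lemma uni_iterator_id n k (a : R * R) (b : 'rV[R]_P) :
  uni_iterator zeta n k a b a = (uni_restr b, b).
Proof.
by rewrite /uni_iterator addrAC subrr add0r emp_var_ge0 transform_id.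
Qed.

Context {I : nat}.
Variables (D : 'I_I -> set R) (dflt : 'I_I -> R * R).

(** Since [n <= k] rules out the exceptional choice of [a] for [alpha], [alpha] is the restriction
    of [b] to the region. The fallback branch then agrees by definition, and only the moving branch
    needs an argument. *)
Lemma multi_iterator_region_id n k i (a : R * (R * R)) (b : 'rV[R]_P) :
  (n <= k)%N ->
  multi_iterator_region D dflt zeta n k i a b a =
  (multi_restr_region D dflt b i, b).
Proof.
move=> le_nk.
rewrite /multi_iterator_region ltnNge le_nk andbF addrAC subrr add0r.
case: ifPn => // /and3P[b_i _ _]; congr pair.
(* The moving branch requires a nonzero fraction, so [dflt i] is never the target of the
   transformation. *)
rewrite /multi_restr_region /=; case: ifPn => [/eqP b0|_].
  by rewrite /fraction b0 mul0r eqxx in b_i.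
exact: transform_id.
Qed.

Lemma assemble_id (b : 'rV[R]_P) : assemble D b (fun=> b) = b.
Proof. by apply/rowP => p; rewrite mxE; case: pickP. Qed.

Lemma multi_iterator_id n k (a : multi_macro) (b : 'rV[R]_P) :
  (n <= k)%N ->
  multi_iterator D dflt zeta n k a b a = (multi_restr D dflt b, b).
Proof.
move=> le_nk; rewrite /multi_iterator; congr pair.
  by apply/ffunP => i; rewrite !ffunE multi_iterator_region_id.
rewrite -[RHS]assemble_id; congr assemble.
by apply/funext => i; rewrite multi_iterator_region_id.
Qed.

End IteratorsAgreeingCoarseArguments.

Section Errors.
Context {d : measure_display} {Omega : measurableType d} {R : realType}.
Variable Pr : probability Omega R.

Lemma strong_error_refl P (u : Omega -> 'rV[R]_P) : strong_error Pr u u = 0%E.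
Proof.
rewrite /strong_error; elim/big_ind: _ => // [x y -> ->|p _]; first exact: maxxx.
under eq_fun do rewrite subrr normr0.
exact: expectation_cst.
Qed.

(** Integrability makes the expectation finite; an infinite one minus itself would not be 0 in the
    extended reals. *)
Lemma weak_error_refl P (Phi : R -> R) (u : Omega -> 'rV[R]_P) :
  Pr.-integrable [set: Omega] (EFin \o ensemble_mean Phi u) ->
  weak_error Pr Phi u u = 0%E.
Proof.
move=> intPhi; rewrite /weak_error subee ?abse0// unlock.
exact: integrable_fin_num.
Qed.

(** Equality on every realisation makes the two random ensembles equal as functions, so both errors
    compare an ensemble with itself. *)
Lemma converges_exactly_pointwise P (macro : Type) (restr : 'rV[R]_P -> macro)
    (run : Omega -> nat -> nat -> macro * 'rV[R]_P)
    (useq : Omega -> nat -> 'rV[R]_P) :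
  (forall w n k, (n <= k)%N -> run w k n = (restr (useq w n), useq w n)) ->
  converges_exactly Pr restr run useq.
Proof.
move=> run_useq k n le_nk.
have -> : (fun w => (run w k n).2) = useq^~ n.
  by apply/funext => w; rewrite run_useq.
split=> [w||Phi intPhi _]; first by rewrite run_useq.
  exact: strong_error_refl.
exact: weak_error_refl.
Qed.

End Errors.

Theorem mainTheorem2 (R : realType) (d : measure_display)
    (Omega : measurableType d) (Pr : probability Omega R)
    (P : nat) (P_gt0 : (0 < P)%N)
    (mdl : @moment_model R)
    (dt : R) (dt_gt0 : 0 < dt)
    (N : nat -> nat) (N_gt0 : forall n, (0 < N n)%N)
    (T : nat -> R) (T_step : forall n, T n.+1 = T n + (N n)%:R * dt)
    (C : nat -> R * R -> R * R)
    (u0 : 'I_P -> {RV Pr >-> R})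
    (xi : nat -> nat -> 'I_P -> {RV Pr >-> R})
    (xi_iid : iid_standard_normal
       (fun j : nat * nat * 'I_P => xi j.1.1 j.1.2 j.2))
    (zeta : nat -> nat -> 'I_P -> {RV Pr >-> R})
    (zeta_iid : forall n k, iid_standard_normal (zeta n k)) :
  let F (w : Omega) (n : nat) :=
    fine_propagator mdl dt (T n) (fun m => sample (xi n m) w) (N n) in
  let Z (w : Omega) (n k : nat) := sample (zeta n k) w in
  let useq (w : Omega) := sequential (F w) (sample u0 w) in
  let coarse_defined_at (n : nat) := propagates mdl (T n) (T n.+1) (C n) in
  (let run (w : Omega) := unimodal C (F w) (Z w) (sample u0 w) in
   (forall w k n, coarse_defined_at n (run w k n).1) ->
   converges_exactly Pr uni_restr run useq)
  /\
  (forall (I : nat) (D : 'I_I -> set R) (dflt : 'I_I -> R * R),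
     trivIset [set: 'I_I] D -> \bigcup_i D i = [set: R] ->
     let run (w : Omega) := multimodal D dflt C (F w) (Z w) (sample u0 w) in
     (forall w k n i, coarse_defined_at n ((run w k n).1 i).2) ->
     converges_exactly Pr (multi_restr D dflt) run useq).
Proof.
move=> F Z useq coarse_defined_at.
(* For fixed [w] all draws are fixed and [F w] is one deterministic family shared by all iterations
   and by [useq w], so termination applies realisation by realisation. *)
split=> [run _|I D dflt _ _ run _]; apply: converges_exactly_pointwise => w n k.
  apply: parareal_finite_termination => m j a b _; exact: uni_iterator_id.
by apply: parareal_finite_termination => m j a b; exact: multi_iterator_id.
Qed.
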